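(* Let $I$ be a homogeneous radical ideal in $\mathbb{K}[\mathbb{P}^n]$. Then for every positive integer $t$ the limit $$\lim_{m\to\infty}\frac{\operatorname{HF}_{I^{(m)}}(mt)}{m^n}$$ exists.
   Context: $\mathbb{K}$ is an algebraically closed field of characteristic zero, $n$ is a positive integer, and $\mathbb{K}[\mathbb{P}^n]=\mathbb{K}[x_1,\dots,x_{n+1}]$ with the standard grading. The $m$-th symbolic power of a homogeneous radical ideal $I$ is $I^{(m)}=\mathbb{K}[\mathbb{P}^n]\cap\bigcap_{Q\in\operatorname{Ass}(I)}(I^m)_Q$, where the localizations are embedded in the field of fractions of $\mathbb{K}[\mathbb{P}^n]$. For a homogeneous ideal $J$, $\operatorname{HF}_J(t)=\dim_{\mathbb{K}}(\mathbb{K}[\mathbb{P}^n]_t/J_t)$ is its Hilbert function. *)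

(* Defs.v *)
From HB Require Import structures.
From mathcomp Require Export all_boot all_order all_algebra.
From mathcomp Require Export mpoly.
From mathcomp Require Export boolp classical_sets.
From mathcomp Require Export reals topology normedtype sequences.

Set Implicit Arguments.
Unset Strict Implicit.
Unset Printing Implicit Defensive.

Import GRing.Theory.
Local Open Scope classical_set_scope.
Local Open Scope ring_scope.

Section Ideals.
Variable R : comNzRingType.
Implicit Types I J Q : set R.

(* The ideals of ring_quotient.v are proper and decidable; here an ideal is an
   arbitrary set, and the unit ideal is allowed. *)
Definition is_ideal I : Prop :=
  [/\ I 0, forall f g, I f -> I g -> I (f + g) & forall a f, I f -> I (a * f)].

Definition radical_ideal I : Prop :=
  is_ideal I /\ forall f k, I (f ^+ k) -> I f.

Definition prime_ideal Q : Prop :=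
  [/\ is_ideal Q, ~ Q 1 & forall f g, Q (f * g) -> Q f \/ Q g].

Definition ideal_mul I J : set R :=
  smallest is_ideal [set f * g | f in I & g in J].

Fixpoint ideal_power I (m : nat) : set R :=
  if m is m'.+1 then ideal_mul I (ideal_power I m') else setT.

(* Ass(I): the primes of R that are annihilators of an element of R / I. *)
Definition Ass I : set (set R) :=
  [set Q | prime_ideal Q /\ exists f, Q = [set g | I (g * f)]].

End Ideals.

Section SymbolicPower.
Variable R : idomainType.
Implicit Types I J Q : set R.

(* J_Q inside the fraction field of R, for Q a prime ideal *)
Definition localization J Q : set {fraction R} :=
  [set tofrac a / tofrac s | a in J & s in ~` Q].

Definition symbolic_power I (m : nat) : set R :=
  \bigcap_(Q in Ass I) (@tofrac R @^-1` localization (ideal_power I m) Q).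

End SymbolicPower.

Section Hilbert.
Variables (K : fieldType) (n : nat).
Implicit Type J : set {mpoly K[n]}.

Definition homogeneous J : Prop :=
  forall f d, J f -> J (pihomog mdeg d f).

(* The classes of b_0, ..., b_(d-1) form a K-basis of K[x_1, ..., x_n]_t / J_t. *)
Definition quotient_basis J (t d : nat) (b : 'I_d -> dhomog n K t) : Prop :=
  (forall p : dhomog n K t,
     exists c : 'I_d -> K, J (val (p - \sum_i c i *: b i))) /\
  (forall c : 'I_d -> K, J (val (\sum_i c i *: b i)) -> forall i, c i = 0).

(* For J an ideal the default value 0 is never used: a basis exists and its size
   is unique, see quotient_basis_exists and hilbert_functionP. *)
Definition hilbert_function J (t : nat) : nat :=
  xget 0%N [set d | exists b : 'I_d -> dhomog n K t, quotient_basis J b].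

End Hilbert.

Section HilbertTheory.
Variables (K : fieldType) (n t : nat) (J : set {mpoly K[n.+1]}).
Hypothesis JI : is_ideal J.
Local Notation V := (dhomog n.+1 K t).

Let JZ (c : K) (p : V) : J (val p) -> J (val (c *: p)).
Proof. by case: JI => _ _ JM Jp; rewrite linearZ /= -mul_mpolyC; apply: JM. Qed.

Let JD (p q : V) : J (val p) -> J (val q) -> J (val (p + q)).
Proof. by case: JI => _ JA _ Jp Jq; rewrite linearD; apply: JA. Qed.

Let J0 : J (val (0 : V)).
Proof. by case: JI => J0 _ _; rewrite linear0. Qed.

Lemma graded_partP : exists U : {vspace V}, forall p, p \in U <-> J (val p).
Proof.
pose P k := `[< exists U : {vspace V}, \dim U = k /\ forall p, p \in U -> J (val p) >].
have P0 : exists k, P k.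
  by exists 0%N; apply/asboolP; exists 0%VS; rewrite dimv0; split=> // p /[!memv0] /eqP ->.
have Ple k : P k -> (k <= \dim {:V})%N.
  by move=> /asboolP[U [<- _]]; apply/dimvS/subvf.
case: (ex_maxnP P0 Ple) => k /asboolP[U [dU UJ]] kmax.
exists U => p; split; first exact: UJ.
move=> Jp; apply: contrapT => /negP pU.
suff /kmax : P (\dim (U + <[p]>)).
  by rewrite -dU => /(conj (addvSl U <[p]>)) /andP;
  rewrite -eqEdim => /eqP E;
  move: pU; rewrite E memvE addvSr.
apply/asboolP; exists (U + <[p]>)%VS; split=> // q /memv_addP[u /UJ Ju [v]].
by move=> /vlineP[c ->] ->; apply: JD => //; apply: JZ.
Qed.

Lemma quotient_basis_dim (U : {vspace V}) (UJ : forall p, p \in U <-> J (val p))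
  d (b : 'I_d -> V) : quotient_basis J b -> (d + \dim U = \dim {:V})%N.
Proof.
move=> [gen ind].
pose X := [tuple b i | i < d].
have Xs (c : 'I_d -> K) : \sum_i c i *: X`_i = \sum_i c i *: b i.
  by apply: eq_bigr => i _; rewrite -tnth_nth tnth_mktuple.
have fX : free X.
  apply/freeP => c; rewrite Xs => c0; apply: ind; rewrite c0; exact: J0.
have dX : \dim <<X>> = d by move: fX; rewrite /free size_tuple => /eqP.
have XU : (<<X>> :&: U = 0)%VS.
  apply/eqP; rewrite -subv0; apply/subvP => v /memv_capP[/coord_span -> ].
  by rewrite Xs => /UJ /ind c0; rewrite big1 ?mem0v // => i _; rewrite c0 scale0r.
have -> : (fullv = <<X>> + U :> {vspace V})%VS.
  apply/eqP; rewrite eqEsubv subvf andbT; apply/subvP => p _.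
  have [c /UJ Uc] := gen p.
  rewrite -[p](subrK (\sum_i c i *: b i)) addrC memv_add //.
  by rewrite -Xs; apply: memv_suml => i _; apply/memvZ/memv_span/mem_nth; rewrite size_tuple.
by rewrite (dimv_disjoint_sum XU) dX.
Qed.

Lemma quotient_basis_exists : exists d (b : 'I_d -> V), quotient_basis J b.
Proof.
have [U UJ] := graded_partP.
exists (\dim U^C), (tnth (vbasis U^C)); split.
  move=> p; have /memv_addP[u uU [w wW ->]] : p \in (U + U^C)%VS.
    by rewrite addv_complf memvf.
  exists (fun i => coord (vbasis U^C) i w); apply/UJ.
  rewrite {1}(coord_vbasis wW).
  under eq_bigr do rewrite -tnth_nth.
  by rewrite addrK.
move=> c /UJ cU.
have cC : \sum_i c i *: tnth (vbasis U^C) i \in (U^C)%VS.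
  by apply: memv_suml => i _; apply/memvZ/vbasis_mem/mem_tnth.
have : \sum_i c i *: tnth (vbasis U^C) i \in (U :&: U^C)%VS.
  by rewrite memv_cap cU.
rewrite capv_compl memv0 => /eqP c0 i.
have /freeP -> // := basis_free (vbasisP U^C).
by rewrite -[RHS]c0; apply: eq_bigr => k _; rewrite (tnth_nth 0).
Qed.

Lemma hilbert_functionP d (b : 'I_d -> V) :
  quotient_basis J b -> hilbert_function J t = d.
Proof.
have [U UJ] := graded_partP; rewrite /hilbert_function => Jb.
case: xgetP => [e _ [b' /(quotient_basis_dim UJ) Eb']|/(_ d)[]]; last by exists b.
by apply/eqP; rewrite -(eqn_add2r (\dim U)) Eb' (quotient_basis_dim UJ Jb).
Qed.
End HilbertTheory.

(* Main.v *)
From HB Require Import structures.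
Require Import Defs.
From mathcomp Require Import ring zify.

(* Let a(m) be the dimension of W_m, the part of degree m t of I^(m), so that
   HF(m t) = 'C(m t + n, n) - a(m).

   If some nonzero homogeneous f0 in I^(m0) has degree < m0 t, compare leading
   monomials.  Raising the f in W_M to the power k, and multiplying by a power of
   f0 (which lowers the degree below the allowed one) and by monomials filling a
   cube of side k, gives a(k (M + c) + r) >= k^n a(M) for a constant c, r bounded
   and k large; hence a(m) / m^n tends to the supremum of a(M) / (M + c)^n.

   If I is the irrelevant ideal, W_m is everything.  Otherwise, if there is no
   such f0, let p be the Fermat form of degree t + 1.  It has multiplicity at
   most one along every associated prime of I, so p g in I^(m) implies g in
   I^(m-1).  For g homogeneous of degree m t - t - 1 < (m - 1) t this forces
   g = 0, so W_m meets the multiples of p trivially and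
   a(m) <= 'C(m t + n, n) - 'C(m t - t - 1 + n, n) = o(m^n). *)

Set Implicit Arguments.
Unset Strict Implicit.
Unset Printing Implicit Defensive.

Import Order.TTheory GRing.Theory Num.Theory.
Import numFieldNormedType.Exports.
Local Open Scope classical_set_scope.
Local Open Scope ring_scope.

(** * Ordinary and symbolic powers *)

Section IdealPowers.
Variable R : comNzRingType.
Implicit Types (I J Q : set R) (f g : R).

Lemma is_idealB I f g : is_ideal I -> I f -> I g -> I (f - g).
Proof. by case=> _ ID IM If Ig; apply: ID => //; rewrite -mulN1r; apply: IM. Qed.

Lemma ideal_mul_ideal I J : is_ideal (ideal_mul I J).
Proof.
split=> [|f g If Ig|a f If] A [AI GA].
- by case: AI.
- by case: (AI) => _ AD _; apply: AD; [apply: If|apply: Ig].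
- by case: (AI) => _ _; apply; apply: If.
Qed.

Lemma ideal_mul_sub I J (A : set R) : is_ideal A ->
  (forall f g, I f -> J g -> A (f * g)) -> ideal_mul I J `<=` A.
Proof. by move=> AI IJ f; apply; split=> // _ [g Ig [h Jh] <-]; apply: IJ. Qed.

Lemma mem_ideal_mul I J f g : I f -> J g -> ideal_mul I J (f * g).
Proof. by move=> If Jg A [_ GA]; apply: GA; exists f => //; exists g. Qed.

Lemma ideal_power_ideal I m : is_ideal (ideal_power I m).
Proof. by case: m => [|m] //=; apply: ideal_mul_ideal. Qed.

Lemma ideal_powerS I m : ideal_power I m.+1 `<=` ideal_power I m.
Proof.
have [_ _ IM] := ideal_power_ideal I m.
by apply: ideal_mul_sub => [|f g _]; [exact: ideal_power_ideal|exact: IM].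
Qed.

Lemma ideal_power_le I m k : (m <= k)%N -> ideal_power I k `<=` ideal_power I m.
Proof.
move=> /subnK <-; elim: (k - m)%N => [//|j IH] f.
by rewrite addSn => /ideal_powerS /IH.
Qed.

Lemma ideal_powerD I a b f g :
  ideal_power I a f -> ideal_power I b g -> ideal_power I (a + b) (f * g).
Proof.
move=> + Ig; elim: a f => [|a IH] f.
  by case: (ideal_power_ideal I b) => _ _ IM _; apply: IM.
(* The elements that multiply [g] into the given power form an ideal, so it is enough to treat the
   generating products. *)
move: f; apply: (@ideal_mul_sub _ _ [set f | ideal_power I (a.+1 + b) (f * g)]).
  have [I0 ID IM] := ideal_power_ideal I (a.+1 + b).
  split=> [|f h /= If Ih|c f /= If]; first by rewrite /= mul0r.
    by rewrite mulrDl; apply: ID.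
  by rewrite -mulrA; apply: IM.
by move=> f h If /IH Ih /=; rewrite -mulrA; apply: mem_ideal_mul.
Qed.

Lemma ideal_power_exp I f k : I f -> ideal_power I k (f ^+ k).
Proof. by move=> If; elim: k => [|k IH] //=; rewrite exprS; apply: mem_ideal_mul. Qed.

(* The contraction to R of the localization at Q of I ^ m. *)
Definition local_power I Q m : set R :=
  [set f | exists2 s, ~ Q s & ideal_power I m (s * f)].

Section Local.
Variables (I Q : set R).
Hypothesis Qprime : prime_ideal Q.
Local Notation A := (local_power I Q).

Lemma prime_mulC f g : ~ Q f -> ~ Q g -> ~ Q (f * g).
Proof. by case: Qprime => _ _ QM Qf Qg /QM[]. Qed.

Lemma local_power_ideal m : is_ideal (A m).
Proof.
have [I0 ID IM] := ideal_power_ideal I m; have [_ Q1 _] := Qprime.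
split=> [|f g [s Qs If] [r Qr Ig]|a f [s Qs If]].
- by exists 1 => //; rewrite mulr0.
- exists (s * r); first exact: prime_mulC.
  have -> : s * r * (f + g) = r * (s * f) + s * (r * g) by ring.
  by apply: ID; apply: IM.
- by exists s => //; rewrite mulrCA; apply: IM.
Qed.

Lemma local_powerV m u f : ~ Q u -> A m (u * f) -> A m f.
Proof.
by move=> Qu [s Qs]; rewrite mulrA => Isuf; exists (s * u) => //; apply: prime_mulC.
Qed.

Lemma sub_local_power m : ideal_power I m `<=` A m.
Proof. by have [_ Q1 _] := Qprime => f If; exists 1; rewrite ?mul1r. Qed.

Lemma local_power_le m k : (m <= k)%N -> A k `<=` A m.
Proof. by move=> mk f [s Qs If]; exists s => //; apply: ideal_power_le If. Qed.

Lemma local_powerD a b f g : A a f -> A b g -> A (a + b) (f * g).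
Proof.
move=> [s Qs If] [r Qr Ig]; exists (s * r); first exact: prime_mulC.
by rewrite mulrACA; apply: ideal_powerD.
Qed.

Lemma local_power_exp f k : A 1 f -> A k (f ^+ k).
Proof.
move=> Af; elim: k => [|k IH]; first exact: sub_local_power.
by rewrite exprS -addn1 addnC; apply: local_powerD.
Qed.

(** * Derivations and orders of vanishing along a prime *)

Variable D : R -> R.
Hypothesis DB : {morph D : f g / f - g}.
Hypothesis DM : forall f g, D (f * g) = D f * g + f * D g.

Let D0 : D 0 = 0. Proof. by rewrite -{1}(subrr 0) DB subrr. Qed.

Let DD : {morph D : f g / f + g}.
Proof. by move=> f g; rewrite -{1}[g]opprK -[- g]sub0r !DB D0 sub0r opprK. Qed.

(** By the Leibniz rule, differentiating a product of m + 1 elements of I, with any coefficient,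
    leaves at least m of them untouched. *)
Lemma derivation_ideal_power m f : ideal_power I m.+1 f -> ideal_power I m (D f).
Proof.
elim: m f => [//|m IH] f If.
have [I0 ID IM] := ideal_power_ideal I m.+1.
(* Membership of [f] itself is carried along because D (a f) contains the term D a * f; the
   condition on D f alone need not define an ideal. *)
suff [] : [set f | ideal_power I m.+1 (D f) /\ ideal_power I m.+1 f] f by [].
move: f If; apply: ideal_mul_sub => [|f g If /[dup] Ig /IH IDg].
  split=> [|f g [? ?] [? ?]|a f [? ?]] /=; first by rewrite D0.
    by rewrite DD; split; apply: ID.
  by rewrite DM; split; [apply: ID; apply: IM|apply: IM].
split; last exact: IM.
by rewrite DM; apply: ID; [apply: IM|apply: mem_ideal_mul].
Qed.

Lemma derivation_local_power m f : A m.+1 f -> A m (D f).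
Proof.
move=> [s Qs If]; exists (s * s); first exact: prime_mulC.
have [_ _ IM] := ideal_power_ideal I m.
(* The quotient rule cleared of denominators: s f lies in I ^ (m + 1), hence D (s f) in I ^ m. *)
have -> : s * s * D f = s * D (s * f) - D s * (s * f) by rewrite DM; ring.
apply: is_idealB; first exact: ideal_power_ideal.
  exact/IM/derivation_ideal_power.
exact/IM/ideal_powerS.
Qed.

Hypothesis natQ : forall j : nat, ~ Q j.+1%:R.
Variable p : R.
Hypotheses (Dp : ~ Q (D p)) (Ap : ~ Q p \/ A 1 p).

Let Dexp j : D (p ^+ j.+1) = j.+1%:R * D p * p ^+ j.
Proof.
elim: j => [|j IH]; first by rewrite expr1 expr0 mul1r mulr1.
by rewrite exprS DM IH exprS -[j.+2%:R]natr1; ring.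
Qed.

(* Since D p is a unit at Q, p behaves as a local parameter: by induction on j,
   g lies in (I^m)_Q + p^j R_Q for every j, hence in (I^m)_Q for j = m. *)
Lemma local_power_cancel m g : A m.+1 (p * g) -> A m g.
Proof.
case: Ap => [Qp /(local_powerV Qp)|Ap1 Apg]; first exact/local_power_le.
have [_ ADS _] := local_power_ideal m.+1.
have [A0 AD AM] := local_power_ideal m.
suff H i : exists2 e, ~ Q e & exists r, A m (e * g - p ^+ i * r).
  have [e Qe [r Aegr]] := H m.
  apply: (local_powerV Qe); rewrite -[e * g](subrK (p ^+ m * r)); apply: AD => //.
  by rewrite mulrC; apply: AM; apply: local_power_exp.
elim: i => [|i [e Qe [r Aa]]].
  by exists 1; [case: Qprime|exists g; rewrite expr0 !mul1r subrr].
set a := e * g - p ^+ i * r in Aa.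
(* Here p g has order m + 1 by assumption, and so has p a, because p has order at least 1 and a
   order at least m. *)
have Apr : A m.+1 (p ^+ i.+1 * r).
  have -> : p ^+ i.+1 * r = e * (p * g) - p * a by rewrite /a exprS; ring.
  apply: is_idealB; first exact: local_power_ideal.
    by case: (local_power_ideal m.+1) => _ _; apply.
  by rewrite -[m.+1]add1n; apply: local_powerD.
(* Differentiation puts (i + 1) (D p) p^i r + p^(i + 1) D r in order m. This trades p^i r for a
   multiple of p^(i + 1), at the cost of the local unit (i + 1) D p. *)
have /derivation_local_power := Apr; rewrite DM Dexp => ADr.
exists (i.+1%:R * D p * e); first exact/prime_mulC/Qe/prime_mulC.
exists (- D r).
have -> : i.+1%:R * D p * e * g - p ^+ i.+1 * - D r =
  i.+1%:R * D p * a + (i.+1%:R * D p * p ^+ i * r + p ^+ i.+1 * D r).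
  by rewrite /a; ring.
by apply: AD => //; apply: AM.
Qed.

End Local.
End IdealPowers.

Section SymbolicPowers.
Variable R : idomainType.
Implicit Types (I Q : set R) (f g : R).

(** Clearing denominators, which are nonzero because they lie outside a prime, moves the definition
    from the fraction field into R. *)
Lemma symbolic_powerP I m f :
  symbolic_power I m f <-> forall Q, Ass I Q -> local_power I Q m f.
Proof.
split=> H Q AQ; have [Qprime _] := AQ; have [[Q0 _ _] _ _] := Qprime.
- have [a Ia [s Qs E]] := H Q AQ.
  have s0 : tofrac s != 0 by rewrite tofrac_eq0; apply/eqP => s0; apply: Qs; rewrite s0.
  exists s => //; suff -> : s * f = a by [].
  by apply/eqP; rewrite -tofrac_eq tofracM -E mulrC divfK.
- have [s Qs Isf] := H Q AQ.
  have s0 : tofrac s != 0 by rewrite tofrac_eq0; apply/eqP => s0; apply: Qs; rewrite s0.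
  exists (s * f) => //; exists s => //.
  by rewrite tofracM mulrAC mulfV // mul1r.
Qed.

Lemma symbolic_power_ideal I m : is_ideal (symbolic_power I m).
Proof.
have A Q : Ass I Q -> is_ideal (local_power I Q m).
  by move=> [Qprime _]; apply: local_power_ideal.
split=> [|f g /symbolic_powerP If /symbolic_powerP Ig|a f /symbolic_powerP If];
  apply/symbolic_powerP => Q AQ; case: (A Q AQ) => A0 AD AM //.
- by apply: AD; [apply: If|apply: Ig].
- exact/AM/If.
Qed.

Lemma symbolic_powerD I a b f g :
  symbolic_power I a f -> symbolic_power I b g -> symbolic_power I (a + b) (f * g).
Proof.
move=> /symbolic_powerP If /symbolic_powerP Ig; apply/symbolic_powerP => Q AQ.
by apply: local_powerD; [case: AQ|apply: If|apply: Ig].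
Qed.

Lemma symbolic_power_le I m k : (m <= k)%N -> symbolic_power I k `<=` symbolic_power I m.
Proof.
move=> mk f /symbolic_powerP If; apply/symbolic_powerP => Q AQ.
exact: local_power_le mk _ (If Q AQ).
Qed.

Lemma sub_symbolic_power I m : ideal_power I m `<=` symbolic_power I m.
Proof.
move=> f If; apply/symbolic_powerP => Q [Qprime _]; exact: sub_local_power.
Qed.

(** If Q annihilates f modulo I and f were in Q, then f^2, hence f, would lie in I, and 1 in Q. So I
    and Q agree after localization at Q. *)
Lemma Ass_radical I Q : radical_ideal I -> Ass I Q ->
  exists2 f, ~ Q f & forall g, Q g <-> I (g * f).
Proof.
move=> [_ Irad] [[_ Q1 _] [f EQ]]; exists f; last by move=> g; rewrite EQ.
rewrite EQ => /(Irad f 2%N) If.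
by apply: Q1; rewrite EQ /= mul1r.
Qed.

End SymbolicPowers.

(** * Leading monomials *)

Section LeadingMonomials.
Variables (K : fieldType) (n d : nat).
Local Notation V := (dhomog n.+1 K d).
Implicit Types (U : {vspace V}) (m : 'X_{1..n.+1}).

Definition lead_of U m : Prop := exists f : V, [/\ f \in U, f != 0 & mlead f = m].

(** Elements with distinct leading monomials are linearly independent: in a combination, the largest
    leading monomial with a nonzero coefficient cannot cancel. *)
Lemma lead_of_le_dim U (s : seq 'X_{1..n.+1}) :
  uniq s -> (forall m, m \in s -> lead_of U m) -> (size s <= \dim U)%N.
Proof.
move=> s_uniq sU.
have F (i : 'I_(size s)) : {f : V | [/\ f \in U, f != 0 & mlead f = nth 0%MM s i]}.
  by apply/cid/sU/mem_nth.
pose X := [tuple sval (F i) | i < size s].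
have X_free : free X.
  apply/freeP => c; have -> : \sum_i c i *: X`_i = \sum_i c i *: sval (F i).
    by apply: eq_bigr => i _; rewrite -tnth_nth tnth_mktuple.
  move=> c0 j; apply/eqP/negPn/negP => cj.
  pose P i := c i != 0.
  have [i Pi imax] := @arg_maxP _ _ _ j P (fun i => mlead (sval (F i) : {mpoly K[n.+1]})) cj.
  move/(congr1 (fun p : V => (p : {mpoly K[n.+1]})@_(mlead (sval (F i))))): c0.
  rewrite linear_sum raddf_sum /= mcoeff0 (bigD1 i) //= big1 ?addr0 => [|k ki].
    rewrite mcoeffZ => /eqP; rewrite mulf_eq0 mleadc_eq0 (negPf Pi) /=.
    by apply/negP; case: (svalP (F i)).
  rewrite mcoeffZ; have [->|ck] := eqVneq (c k) 0; first by rewrite mul0r.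
  rewrite mcoeff_gt_mlead ?mulr0 // lt_neqAle (imax k ck : (_ <= _)%O) andbT.
  case: (svalP (F i)) (svalP (F k)) => _ _ -> [_ _ ->].
  by rewrite nth_uniq.
have XU : (<<X>> <= U)%VS.
  by apply/span_subvP => _ /mapP[i _ ->]; case: (svalP (F i)).
move/dimvS: XU; apply: leq_trans.
by move: X_free; rewrite /free size_tuple => /eqP->.
Qed.

(** Reading off the coefficients at all leading monomials of U is injective on U, since a nonzero
    element has a nonzero leading coefficient. *)
Lemma exists_leads U : exists s : seq 'X_{1..n.+1},
  [/\ uniq s, forall m, m \in s -> lead_of U m & (\dim U <= size s)%N].
Proof.
pose s := [seq bmnm b | b <- enum {: 'X_{1..n.+1 < d.+1}} & `[< lead_of U (bmnm b) >]].
exists s; split.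
- rewrite map_inj_uniq => [|x y /eqP]; last by rewrite -bmeqP => /eqP.
  exact/filter_uniq/enum_uniq.
- by move=> m /mapP[k + ->]; rewrite mem_filter => /andP[/asboolP].
pose c (f : V) : 'rV[K]_(size s) := \row_i (f : {mpoly K[n.+1]})@_(nth 0%MM s i).
have c_linear : linear c.
  by move=> a f g; apply/rowP => i; rewrite !mxE -mcoeffZ -mcoeffD.
pose cL := GRing.isLinear.Build K V 'rV[K]_(size s) _ c c_linear.
pose C : {linear V -> 'rV[K]_(size s)} := HB.pack c cL.
rewrite -(limg_ker_dim (linfun C) U).
have -> : (U :&: lker (linfun C) = 0)%VS.
  apply/eqP; rewrite -subv0; apply/subvP => f /memv_capP[fU].
  rewrite memv_ker lfunE /= memv0 => /eqP /rowP f0; apply/negPn/negP => fN0.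
  have fl : mdeg (mlead f) = d.
    have /dhomogP := dhomog_is_dhomog f; apply; exact: mlead_supp.
  have ms : mlead f \in s.
    have ml : (mdeg (mlead f) < d.+1)%N by rewrite fl.
    apply/mapP; exists (BMultinom ml) => //; rewrite mem_filter mem_enum andbT.
    by apply/asboolP; exists f.
  have := ms; rewrite -index_mem => il.
  have := f0 (Ordinal il); rewrite !mxE /= nth_index // => /eqP.
  by rewrite mleadc_eq0; apply/negP.
rewrite dimv0 add0n (leq_trans (dimvS (subvf _))) // dimvf /dim /= mul1n //.
Qed.

End LeadingMonomials.

(** * Dimensions of graded parts *)

Section GradedParts.
Variables (K : fieldType) (n : nat).
Implicit Types (J : set {mpoly K[n.+1]}) (d : nat).

(** For an ideal J this is the dimension of its degree d part, by [graded_dimP]; the truncated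
    subtraction is then exact, by [hilbert_function_dim]. *)
Definition graded_dim J d : nat := ('C(d + n, d) - hilbert_function J d)%N.

Lemma graded_dimP J d : is_ideal J ->
  exists U : {vspace dhomog n.+1 K d},
    (forall f, f \in U <-> J (val f)) /\ graded_dim J d = \dim U.
Proof.
move=> JI; have [U UJ] := graded_partP d JI; exists U; split=> //.
have [h [b hb]] := quotient_basis_exists d JI.
have := quotient_basis_dim JI UJ hb.
by rewrite /graded_dim (hilbert_functionP JI hb) dimvf /dim /= => <-; rewrite addKn.
Qed.

Lemma hilbert_function_dim J d : is_ideal J ->
  (hilbert_function J d + graded_dim J d = 'C(d + n, d))%N.
Proof.
move=> JI; have [U UJ] := graded_partP d JI.
have [h [b hb]] := quotient_basis_exists d JI.
have := quotient_basis_dim JI UJ hb.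
by rewrite /graded_dim (hilbert_functionP JI hb) dimvf /dim /= => <-; rewrite addKn.
Qed.

Lemma graded_dim_le J d : (graded_dim J d <= 'C(d + n, d))%N.
Proof. exact: leq_subr. Qed.

Lemma graded_dim_full J d : is_ideal J ->
  (forall f : {mpoly K[n.+1]}, f \is d.-homog -> J f) -> graded_dim J d = 'C(d + n, d).
Proof.
move=> JI Jd; have [U [UJ ->]] := graded_dimP d JI.
have -> : U = fullv; last by rewrite dimvf.
apply/eqP; rewrite eqEsubv subvf; apply/subvP => f _; apply/UJ/Jd.
exact: dhomog_is_dhomog.
Qed.

(** Multiplication by p embeds the forms of degree b into degree d, and the image meets J trivially,
    so the two dimensions add inside the space of all forms. *)
Lemma graded_dim_mul J p N b d : is_ideal J -> p != 0 -> p \is N.-homog ->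
  (N + b = d)%N ->
  (forall g, g \is b.-homog -> J (p * g) -> g = 0) ->
  (graded_dim J d + 'C(b + n, b) <= 'C(d + n, d))%N.
Proof.
move=> JI p0 hp <- Jp; have [U [UJ ->]] := graded_dimP (N + b) JI.
pose mulp (g : dhomog n.+1 K b) : dhomog n.+1 K (N + b) :=
  DHomog (dhomogM hp (dhomog_is_dhomog g)).
have mulp_linear : linear mulp.
  move=> a f g; apply: val_inj => /=.
  by rewrite scalerAr -mulrDr.
pose mL := GRing.isLinear.Build K _ _ _ mulp mulp_linear.
pose Mp : {linear dhomog n.+1 K b -> dhomog n.+1 K (N + b)} := HB.pack mulp mL.
have inj : (fullv :&: lker (linfun Mp) = 0)%VS.
  apply/eqP; rewrite -subv0; apply/subvP => g /memv_capP[_].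
  rewrite memv_ker lfunE /= memv0 => /eqP /(congr1 val) /= /eqP.
  by rewrite mulf_eq0 (negPf p0) /= => /eqP g0; apply/eqP/val_inj.
have UM : (U :&: limg (linfun Mp) = 0)%VS.
  apply/eqP; rewrite -subv0; apply/subvP => f /memv_capP[/UJ Jf /memv_imgP[g _ E]].
  move: Jf; rewrite E lfunE /= => /Jp g0; rewrite memv0.
  by apply/eqP/val_inj; rewrite /= g0 ?mulr0 // dhomog_is_dhomog.
have dimb : \dim (fullv : {vspace dhomog n.+1 K b}) = 'C(b + n, b) by rewrite dimvf.
have := limg_ker_dim (linfun Mp) fullv; rewrite inj dimv0 add0n dimb => <-.
by rewrite -dimv_disjoint_sum // (leq_trans (dimvS (subvf _))) // dimvf.
Qed.

End GradedParts.

(** * Cubes of monomials in graded families of ideals *)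

Section GradedFamily.
Variables (K : fieldType) (n : nat) (J : nat -> set {mpoly K[n.+1]}).
Hypothesis J_ideal : forall m, is_ideal (J m).
Hypothesis J_full : forall f, J 0 f.
Hypothesis J_le : forall m k, (m <= k)%N -> J k `<=` J m.
Hypothesis J_mul : forall a b f g, J a f -> J b g -> J (a + b) (f * g).

Lemma graded_family_exp a f k : J a f -> J (a * k) (f ^+ k).
Proof.
move=> Jf; elim: k => [|k IH]; first by rewrite muln0.
by rewrite exprS mulnS; apply: J_mul.
Qed.

Variables (t m0 d0 : nat) (f0 : {mpoly K[n.+1]}).
Hypotheses (Jf0 : J m0 f0) (f0N0 : f0 != 0) (f0_homog : f0 \is d0.-homog).
Hypothesis d0_lt : (d0 < m0 * t)%N.

(** All exponents but the first run over a cube of side k, and the first variable fills the degree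
    up to D. The subtraction is exact once n k <= D. *)
Let box k D (c : {ffun 'I_n -> 'I_k}) : 'X_{1..n.+1} :=
  [multinom oapp (fun j => c j : nat) (D - \sum_j c j)%N (unlift ord0 i) | i < n.+1].

Let box0 k D (c : {ffun 'I_n -> 'I_k}) : box D c ord0 = (D - \sum_j c j)%N.
Proof. by rewrite mnmE unlift_none. Qed.

Let boxS k D (c : {ffun 'I_n -> 'I_k}) (j : 'I_n) : box D c (lift ord0 j) = c j.
Proof. by rewrite mnmE liftK. Qed.

Let mdeg_box k D (c : {ffun 'I_n -> 'I_k}) : (n * k <= D)%N -> mdeg (box D c) = D.
Proof.
move=> nkD; rewrite mdegE big_ord_recl box0.
have -> : (\sum_(j < n) box D c (lift ord0 j) = \sum_j c j)%N.
  by apply: eq_bigr => j _; apply: boxS.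
rewrite subnK // (leq_trans _ nkD) //.
rewrite -[n in (n * _)%N]card_ord -sum_nat_const.
by apply: leq_sum => i _; apply/ltnW/ltn_ord.
Qed.

(* For every leading monomial alpha of J_M in degree M t, the products
   f_alpha^k * f0^e * x^beta with beta_i < k for i > 0 have k^n distinct leading
   monomials k alpha + e (mlead f0) + beta, and those cubes of monomials are
   disjoint for distinct alpha.  The power of f0 leaves enough degree for x^beta. *)
Lemma graded_dim_cube M k r : let L := (M + n.+1 * m0)%N in
  (r <= L)%N -> (d0 * L <= k)%N ->
  (k ^ n * graded_dim (J M) (M * t) <=
     graded_dim (J (k * L + r)) ((k * L + r) * t))%N.
Proof.
move=> L rL Lk; set m := (k * L + r)%N.
have [U [UJ ->]] := graded_dimP (M * t) (J_ideal M).
have [W [WJ ->]] := graded_dimP (m * t) (J_ideal m).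
have [s [s_uniq sU Us]] := exists_leads U.
(* Chosen so that k M + m0 e >= k L + r: the part (n + 1) k m0 equals k (L - M), and m0 L covers r
   <= L. *)
pose e := (n.+1 * k + L)%N.
pose D := (m * t - (k * M * t + d0 * e))%N.
(* After cancelling k M t, the remaining degree is at least (n + 1) k (m0 t - d0) - d0 L >= (n + 1)
   k - k, by d0 < m0 t and d0 L <= k. *)
have Dk : (n * k <= D)%N.
  have : (n.+1 * k * d0.+1 <= n.+1 * k * (m0 * t))%N by rewrite leq_mul2l d0_lt orbT.
  rewrite /D /m /e /L; move: Lk; rewrite /L; nia.
have Dm : (D + (k * M * t + d0 * e) = m * t)%N.
  have : (n.+1 * k * d0.+1 <= n.+1 * k * (m0 * t))%N by rewrite leq_mul2l d0_lt orbT.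
  rewrite /D /m /e /L; move: Lk; rewrite /L; nia.
pose T := [seq (a *+ k + (mlead f0 *+ e + box D c))%MM | a <- s, c <- enum {ffun 'I_n -> 'I_k}].
have s_deg a : a \in s -> mdeg a = (M * t)%N.
  move=> /sU[f [_ fN0 <-]].
  by have /dhomogP := dhomog_is_dhomog f; apply; apply: mlead_supp.
have -> : (k ^ n * \dim U = \dim U * k ^ n)%N by rewrite mulnC.
have sizeT : size T = (size s * k ^ n)%N.
  by rewrite size_allpairs -cardE card_ffun !card_ord.
rewrite (leq_trans (leq_mul Us (leqnn _))) // -sizeT.
apply: lead_of_le_dim.
  apply: allpairs_uniq => //; first exact: enum_uniq.
  move=> _ _ /allpairsP[[a c] /= [/s_deg da _ ->]] /allpairsP[[b c'] /= [/s_deg db _ ->]] /=.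
  move=> /mnmP E.
  (* Division with remainder by k separates a from c in every exponent but the first; equality of
     degrees then settles the first exponent of a. *)
  have Eac (j : 'I_n) : a (lift ord0 j) = b (lift ord0 j) /\ c j = c' j.
    have := E (lift ord0 j); rewrite !mnmDE !boxS !mulmnE.
    rewrite addnCA [RHS]addnCA => /addnI {}E.
    have k0 : (0 < k)%N := leq_ltn_trans (leq0n _) (ltn_ord (c j)).
    split.
      by have := congr1 (fun x => x %/ k)%N E; rewrite /= !divnMDl // !divn_small ?addn0.
    apply: val_inj.
    by have := congr1 (fun x => x %% k)%N E; rewrite /= !modnMDl !modn_small.
  have -> : a = b.
    apply/mnmP => i; case: (unliftP ord0 i) => [j ->|->]; first by case: (Eac j).
    move: da; rewrite -db !mdegE !big_ord_recl.
    have -> : (\sum_j a (lift ord0 j) = \sum_j b (lift ord0 j))%N.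
      by apply: eq_bigr => j _; case: (Eac j).
    by move/addIn.
  by congr (_, _); apply/ffunP => j; case: (Eac j).
move=> _ /allpairsP[[a c] /= [/sU[f [/UJ Jf fN0 <-]] _ ->]].
have fN0' : val f != 0 by apply: contra_neq fN0 => f0E; apply: val_inj.
pose g := val f ^+ k * (f0 ^+ e * 'X_[box D c]) : {mpoly K[n.+1]}.
have XN0 : 'X_[box D c] != 0 :> {mpoly K[n.+1]} by rewrite -msupp_eq0 msuppX.
have gN0 : g != 0 by rewrite !mulf_neq0 ?expf_neq0.
have hg : g \is (m * t).-homog.
  have -> : (m * t = M * t * k + (d0 * e + D))%N by rewrite -Dm; ring.
  apply/dhomogM; first exact/dhomogMn/dhomog_is_dhomog.
  by apply/dhomogM; [apply: dhomogMn|rewrite dhomogX; apply/eqP/mdeg_box].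
exists (DHomog hg); split.
- apply/WJ; rewrite /= /g.
  have Jfe : J (M * k + m0 * e) (val f ^+ k * f0 ^+ e).
    by apply: J_mul; apply: graded_family_exp.
  have m0_gt0 : (0 < m0)%N by case: (m0) d0_lt.
  have mle : (m <= M * k + m0 * e)%N.
    have : (L <= m0 * L)%N by rewrite leq_pmull.
    rewrite /m /e; move: rL; rewrite /L; nia.
  have [_ _ JM] := J_ideal m.
  by rewrite mulrA mulrC; apply/JM/(J_le mle).
- by apply: contra_neq gN0 => /(congr1 val).
- by rewrite /= /g !mleadM ?mulf_neq0 ?expf_neq0 // !mleadX // mleadXm.
Qed.

End GradedFamily.

(** * The Fermat form along associated primes *)

Section PolynomialIdeals.
Variables (K : fieldType) (n : nat).
Implicit Types (I Q : set {mpoly K[n.+1]}) (f g : {mpoly K[n.+1]}).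

Lemma ideal_sum (T : Type) (s : seq T) (P : pred T) (F : T -> {mpoly K[n.+1]}) I :
  is_ideal I -> (forall x, P x -> I (F x)) -> I (\sum_(x <- s | P x) F x).
Proof. by move=> [I0 ID _] IF; elim/big_rec: _ => // x f Px; apply/ID/IF. Qed.

Lemma ideal_monomials I f : is_ideal I ->
  (forall m, m \in msupp f -> I 'X_[m]) -> I f.
Proof.
move=> II If; have [_ _ IM] := II.
rewrite [f]mpolyE big_seq; apply: ideal_sum => // m /If Im.
by rewrite -mul_mpolyC; apply: IM.
Qed.

Lemma monomial_ideal_power I m :
  (forall i, I 'X_i) -> ideal_power I (mdeg m) ('X_[m] : {mpoly K[n.+1]}).
Proof.
move=> IX; rewrite mpolyXE_id mdegE.
elim/big_rec2: _ => // i f k _ If.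
by apply: ideal_powerD => //; apply: ideal_power_exp.
Qed.

Lemma homog_ideal_power I m d f :
  (forall i, I 'X_i) -> (m <= d)%N -> f \is d.-homog -> ideal_power I m f.
Proof.
move=> IX md /dhomogP fd; apply: ideal_monomials; first exact: ideal_power_ideal.
move=> a /fd ad; apply: (@ideal_power_le _ _ _ d) => //; rewrite -ad.
exact: monomial_ideal_power.
Qed.

Lemma variables_sub_ideal Q f :
  is_ideal Q -> (forall i, Q 'X_i) -> f@_0 = 0 -> Q f.
Proof.
move=> QI QX f0; apply: ideal_monomials => // m.
rewrite mcoeff_msupp => fm; have [_ _ QM] := QI.
have [i mi] : exists i, m i != 0%N.
  apply: contrapT => /forallNP m0; move: fm; suff -> : m = 0%MM by rewrite f0 eqxx.
  by apply/mnmP => i; rewrite mnm0E; apply/eqP/negPn/negP/m0.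
have -> : m = (m - U_(i) + U_(i))%MM.
  by rewrite submK //; apply/mnm_lepP => j; rewrite mnm1E; case: eqP => // <-; rewrite lt0n.
by rewrite mpolyXD; apply: QM.
Qed.

(** Let Q annihilate f modulo I, with f outside Q. If Q contained all variables, f would have a
    constant term c != 0. The degree 1 part of x_i0 f, which is c x_i0, would then lie in I by
    homogeneity. *)
Lemma Ass_variable I Q i0 : radical_ideal I -> homogeneous I -> ~ I 'X_i0 ->
  Ass I Q -> exists i, ~ Q 'X_i.
Proof.
move=> Irad Ihom IX AQ; have [f Qf QP] := Ass_radical Irad AQ.
have [[QI _ _] _] := AQ; have [[_ _ IM] _] := Irad.
apply: contrapT => /forallNP /(_ _)/contrapT QX; apply: IX.
have piX (m : 'X_{1..n.+1}) :
    pihomog mdeg 1 'X_[m] = (if mdeg m == 1%N then 'X_[m] else 0) :> {mpoly K[n.+1]}.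
  exact: pihomogX.
pose c := f@_0; pose h := f - c%:MP.
have h0 : h@_0 = 0 by rewrite mcoeffB mcoeffC eqxx mulr1 subrr.
have Qh : Q h by apply: variables_sub_ideal.
have c0 : c != 0.
  by apply: contra_notN Qf => /eqP c0; have := Qh; rewrite /h c0 mpolyC0 subr0.
have /(Ihom _ 1%N) : I ('X_i0 * f) by apply/QP.
have -> : f = c%:MP + h by rewrite addrC subrK.
rewrite mulrDr linearD /=.
have -> : pihomog mdeg 1 ('X_i0 * h) = 0.
  rewrite [h]mpolyE mulr_sumr linear_sum big_seq big1 // => m.
  rewrite mcoeff_msupp => hm.
  rewrite -scalerAr -mpolyXD linearZ /= piX mdegD mdeg1.
  case: eqP; rewrite ?scaler0 // => /eqP; rewrite -[X in _ == X]addn0 eqn_add2l mdeg_eq0.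
  by move=> /eqP m0; rewrite m0 h0 eqxx in hm.
have -> : 'X_i0 * c%:MP = c *: 'X_i0 :> {mpoly K[n.+1]} by rewrite mulrC mul_mpolyC.
rewrite addr0 linearZ /= piX mdeg1 eqxx => /(IM c^-1%:MP).
by rewrite mul_mpolyC scalerA mulVf // scale1r.
Qed.

Definition fermat N : {mpoly K[n.+1]} := \sum_(i < n.+1) 'X_i ^+ N.

Lemma fermat_homog N : fermat N \is N.-homog.
Proof.
apply: rpred_sum => i _.
have : ('X_i : {mpoly K[n.+1]}) \is 1.-homog by rewrite dhomogX; apply/eqP/mdeg1.
by move/(dhomogMn N); rewrite mul1n.
Qed.

Lemma fermat_neq0 N : fermat N.+1 != 0.
Proof.
apply/eqP => /(congr1 (meval (fun i => (i == ord0)%:R : K))).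
rewrite meval0 /fermat raddf_sum /= (bigD1 ord0) //= big1 ?addr0 => [|i /negPf i0].
  by rewrite rmorphXn /= mevalXU eqxx expr1n => /eqP; rewrite oner_eq0.
by rewrite rmorphXn /= mevalXU i0 expr0n.
Qed.

Lemma mderiv_fermat N i : (fermat N.+1)^`M(i) = N.+1%:R * 'X_i ^+ N.
Proof.
rewrite /fermat raddf_sum /= (bigD1 i) //= big1 ?addr0 => [|j ji].
  rewrite !mpolyXn mderivX mulmnE mnm1E eqxx mul1n scaler_nat mulr_natl.
  congr ('X_[_] *+ _); apply/mnmP => k; rewrite mnmBE !mulmnE mulnS addKn //.
by rewrite mpolyXn mderivX mulmnE mnm1E (negPf ji) mul0n scale0r.
Qed.

Hypothesis charK0 : [pchar K] =i pred0.

Lemma prime_ideal_natr Q j : prime_ideal Q -> ~ Q j.+1%:R.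
Proof.
move=> [[_ _ QM] Q1 _] /(QM (j.+1%:R^-1 : K)%:MP); rewrite -mpolyC_nat -mpolyCM mulVf //.
by move/pcharf0P: charK0 => ->.
Qed.

(* Away from the irrelevant ideal the Fermat hypersurface is smooth, so it has
   multiplicity at most one along every associated prime of I. *)
Lemma symbolic_power_fermat I i0 N m g :
  radical_ideal I -> homogeneous I -> ~ I 'X_i0 ->
  symbolic_power I m.+1 (fermat N.+1 * g) -> symbolic_power I m g.
Proof.
move=> Irad Ihom IX /symbolic_powerP Ig; apply/symbolic_powerP => Q AQ.
have [i Qi] := Ass_variable Irad Ihom IX AQ.
have [f Qf QP] := Ass_radical Irad AQ.
have [Qprime _] := AQ; have [_ Q1 _] := Qprime.
(* Differentiate along a variable outside Q: the derivative (N + 1) x_i^N of the Fermat form is then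
   outside Q too. *)
apply: (@local_power_cancel _ I Q Qprime (mderiv i) _ _ _ (fermat N.+1)) => //.
- exact: mderivB.
- exact: mderivM.
- by move=> j; apply: prime_ideal_natr.
- rewrite mderiv_fermat; apply: (prime_mulC Qprime); first exact: prime_ideal_natr.
  by elim: N {Ig} => [//|N IH]; rewrite exprS; apply: prime_mulC.
- have [Qp|] := pselect (Q (fermat N.+1)); last by left.
  (* The multiplier f lies outside Q and sends Q into I, so a Fermat form in Q has order at least
     1. *)
  right; exists f => //; rewrite mulrC -[_ * f]mulr1.
  by apply: mem_ideal_mul => //; apply/QP.
- exact: Ig.
Qed.

End PolynomialIdeals.

(** * Limits *)

Lemma leq_exp2rW m k n : (m <= k)%N -> (m ^ n <= k ^ n)%N.
Proof. by case: n => // n mk; rewrite leq_exp2r. Qed.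

Lemma bin_addC x n : 'C(x + n, x) = 'C(x + n, n).
Proof. by have := bin_sub (leq_addl x n); rewrite addnK. Qed.

(** The middle term is n! times 'C(x + n, n), which is thus squeezed between two n-th powers with
    the same leading term. *)
Lemma expn_le_ffact x n : (x ^ n <= (x + n) ^_ n <= (x + n) ^ n)%N.
Proof.
elim: n => [//|n /andP[IH1 IH2]].
rewrite addnS ffactSS !expnS; apply/andP; split; apply: leq_mul => //.
  by rewrite -addnS leq_addr.
by apply: leq_trans IH2 _; rewrite leq_exp2rW.
Qed.

Section Limits.
Variable R : realType.
Implicit Types (u v : nat -> R) (x l : R).

Lemma cvg_affine_ratio l x : (fun m : nat => (m%:R * l + x) / m%:R : R) @ \oo --> l.
Proof.
have V0 : (fun m : nat => m%:R^-1 : R) @ \oo --> (0 : R).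
  apply/gtr0_cvgV0; last exact: cvgr_idn.
  by near=> m; rewrite ltr0n; near: m; exists 1%N.
have E : \forall m \near \oo, l + x * m%:R^-1 = (m%:R * l + x) / m%:R :> R.
  near=> m; rewrite mulrDl mulrAC mulfV ?mul1r // pnatr_eq0 -lt0n.
  by near: m; exists 1%N.
apply: cvg_trans (near_eq_cvg E) _.
have : (fun m : nat => l + x * m%:R^-1) @ \oo --> l + x * 0.
  by apply: cvgD; [apply: cvg_cst|apply: cvgMr].
by rewrite mulr0 addr0.
Unshelve. all: by end_near. Qed.

Lemma cvg_exp u l n : u @ \oo --> l -> (fun m => u m ^+ n) @ \oo --> l ^+ n.
Proof.
move=> ul; elim: n => [|n IH]; first exact: cvg_cst.
rewrite exprS; under eq_fun do rewrite exprS.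
exact: cvgM.
Qed.

Lemma cvg_binomial (u : nat -> nat) l n :
  (fun m : nat => (u m)%:R / m%:R : R) @ \oo --> l ->
  (fun m : nat => 'C(u m + n, u m)%:R / m%:R ^+ n : R) @ \oo --> l ^+ n / n`!%:R.
Proof.
move=> ul.
have ul' : (fun m : nat => (u m)%:R / m%:R + n%:R / m%:R) @ \oo --> l + 0.
  apply: cvgD => //.
  by have := @cvg_affine_ratio 0 n%:R; under eq_fun do rewrite mulr0 add0r.
rewrite addr0 in ul'.
have nf0 : 0 < n`!%:R :> R by rewrite ltr0n fact_gt0.
apply: (@squeeze_cvgr _ _ _ _ (fun m => ((u m)%:R / m%:R) ^+ n / n`!%:R)
  (fun m => ((u m)%:R / m%:R + n%:R / m%:R) ^+ n / n`!%:R)).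
- near=> m.
  have m0 : 0 < m%:R ^+ n :> R by rewrite exprn_gt0 // ltr0n; near: m; exists 1%N.
  have E : 'C(u m + n, u m)%:R / m%:R ^+ n = ((u m + n) ^_ n)%:R / m%:R ^+ n / n`!%:R :> R.
    rewrite bin_addC -bin_ffact natrM mulrAC.
    by rewrite mulfK ?gt_eqF.
  have /andP[le1 le2] := expn_le_ffact (u m) n.
  rewrite E -mulrDl !exprMn !exprVn.
  by rewrite !ler_pM2r ?invr_gt0 // -!natrX -natrD -natrX !ler_nat le1.
- by apply: cvgMl; apply: cvg_exp.
- by apply: cvgMl; apply: cvg_exp.
Unshelve. all: by end_near. Qed.

Lemma cvg_binomial_mul t n :
  (fun m : nat => 'C(m * t + n, m * t)%:R / m%:R ^+ n : R) @ \oo -->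
    (t%:R ^+ n / n`!%:R : R).
Proof.
apply: (@cvg_binomial (fun m => (m * t)%N)).
have := @cvg_affine_ratio t%:R 0.
by under eq_fun do rewrite addr0 -natrM.
Qed.

(* The limit is the supremum of a M / (M + c) ^ n. *)
Lemma cvg_cube_superadditive (a : nat -> nat) (n c d t : nat) : (0 < c)%N ->
  (forall m, (a m <= 'C(m * t + n, m * t))%N) ->
  (forall M k r, (r <= M + c)%N -> (d * (M + c) <= k)%N ->
     (k ^ n * a M <= a (k * (M + c) + r))%N) ->
  exists l : R, (fun m : nat => (a m)%:R / m%:R ^+ n : R) @ \oo --> l.
Proof.
move=> c_gt0 a_le a_cube.
pose b M : R := (a M)%:R / (M + c)%:R ^+ n.
have Mc_gt0 M : 0 < (M + c)%:R ^+ n :> R by rewrite exprn_gt0 // ltr0n addn_gt0 c_gt0 orbT.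
have b_sup : has_sup (range b).
  split; first by exists (b 0%N), 0%N.
  (* The binomial is at most (M t + n)^n, and M t + n <= (t + n) (M + c) because c >= 1. *)
  exists ((t + n)%:R ^+ n) => _ [M _ <-].
  rewrite /b ler_pdivrMr // -exprMn -natrM -natrX ler_nat.
  apply: (leq_trans (a_le M)).
  have /andP[_ le2] := expn_le_ffact (M * t) n.
  rewrite bin_addC; apply: (@leq_trans ((M * t + n) ^ n)).
    by apply: leq_trans le2; rewrite -bin_ffact leq_pmulr // fact_gt0.
  by apply: leq_exp2rW; nia.
pose l := sup (range b); exists l.
have bl M : b M <= l by apply: sup_upper_bound => //; exists M.
apply/cvgrPdist_lt => e e0.
have [_ [M _ <-] bM] := sup_adherent e0 b_sup.
set L := (M + c)%N.
have L_gt0 : (0 < L)%N by rewrite addn_gt0 c_gt0 orbT.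
have up : (fun m : nat => l * ((m%:R * 1 + c%:R) / m%:R) ^+ n) @ \oo --> l * 1 ^+ n.
  by apply: cvgMr; apply/cvg_exp/cvg_affine_ratio.
have lo : (fun m : nat => b M * ((m%:R * 1 - L%:R) / m%:R) ^+ n) @ \oo --> b M * 1 ^+ n.
  by apply: cvgMr; apply/cvg_exp/cvg_affine_ratio.
rewrite expr1n mulr1 in up; rewrite expr1n mulr1 in lo.
near=> m.
have m_gt0 : (0 < m)%N by near: m; exists 1%N.
have mL : (L <= m)%N by near: m; exists L.
have mn_gt0 : 0 < m%:R ^+ n :> R by rewrite exprn_gt0 // ltr0n.
rewrite distrC ltr_distl; apply/andP; split.
  have : l - e < b M * ((m%:R * 1 - L%:R) / m%:R) ^+ n.
    by near: m; apply: (cvgr_gt _ lo).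
  move/lt_le_trans; apply.
  rewrite mulr1 exprMn exprVn mulrA ler_pM2r ?invr_gt0 //.
  rewrite /b -/L mulrAC ler_pdivrMr; last exact: Mc_gt0.
  rewrite -(natrB R mL) -!natrX -!natrM ler_nat.
  (* The cube bound is used with k the quotient and r the remainder of m by L: a m >= k^n a M, where
     k L >= m - L. *)
  have mE := divn_eq m L.
  apply: (@leq_trans (a M * ((m %/ L) * L) ^ n)).
    rewrite leq_mul2l; apply/orP; right.
    apply: leq_exp2rW.
    by rewrite leq_subLR {1}mE addnC leq_add2r ltnW // ltn_mod.
  rewrite expnMn mulnA leq_mul2r [(a M * _)%N]mulnC; apply/orP; right.
  rewrite [in X in (_ <= X)%N]mE; apply: a_cube; first by rewrite ltnW // ltn_mod.
  by rewrite leq_divRL //; near: m; exists (d * (M + c) * L)%N.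
(* Conversely a m = b m (m + c)^n <= l (m + c)^n, and (m + c) / m tends to 1. *)
have : l * ((m%:R * 1 + c%:R) / m%:R) ^+ n < l + e.
  by near: m; apply: (cvgr_lt _ up); rewrite ltrDl.
apply: le_lt_trans.
rewrite mulr1 exprMn exprVn mulrA ler_pM2r ?invr_gt0 //.
by rewrite -natrD -ler_pdivrMr //; apply: bl.
Unshelve. all: by end_near. Qed.

End Limits.

(** * Asymptotics of symbolic powers *)

Section Waldschmidt.
Variables (R : realType) (K : fieldType) (n : nat).
Hypothesis charK0 : [pchar K] =i pred0.
Variables (I : set {mpoly K[n.+1]}) (t : nat).
Local Notation a m := (graded_dim (symbolic_power I m) (m * t)).

Lemma cvg_graded_dim_big m0 d0 (f0 : {mpoly K[n.+1]}) :
  symbolic_power I m0 f0 -> f0 != 0 -> f0 \is d0.-homog -> (d0 < m0 * t)%N ->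
  exists l : R, (fun m : nat => (a m)%:R / m%:R ^+ n : R) @ \oo --> l.
Proof.
move=> If0 f0N0 hf0 d0_lt.
have m0_gt0 : (0 < m0)%N by case: (m0) d0_lt.
apply: (@cvg_cube_superadditive _ (fun m => a m) n (n.+1 * m0) d0 t).
- by rewrite muln_gt0.
- by move=> m; apply: graded_dim_le.
- move=> M k r; apply: (@graded_dim_cube _ _ (symbolic_power I) _ _ _ _ t m0 d0 f0) => //.
  + exact: symbolic_power_ideal.
  + by move=> f; apply: sub_symbolic_power.
  + by move=> i j; apply: symbolic_power_le.
  + by move=> i j f g; apply: symbolic_powerD.
Qed.

Lemma cvg_graded_dim_small i0 : (0 < t)%N ->
  radical_ideal I -> homogeneous I -> ~ I 'X_i0 ->
  (forall m d (f : {mpoly K[n.+1]}), symbolic_power I m f -> f \is d.-homog ->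
    (d < m * t)%N -> f = 0) ->
  (fun m : nat => (a m)%:R / m%:R ^+ n : R) @ \oo --> (0 : R).
Proof.
move=> t_gt0 Irad Ihom IX I0.
pose C (u : nat -> nat) (m : nat) : R := 'C(u m + n, u m)%:R / m%:R ^+ n.
have C1 : C (fun m => (m * t)%N) @ \oo --> (t%:R ^+ n / n`!%:R : R).
  exact: cvg_binomial_mul.
have C2 : C (fun m => (m * t - t.+1)%N) @ \oo --> (t%:R ^+ n / n`!%:R : R).
  apply: (@cvg_binomial _ (fun m => (m * t - t.+1)%N)).
  apply: cvg_trans (@cvg_affine_ratio R t%:R (- t.+1%:R)).
  apply: near_eq_cvg; near=> m; rewrite natrB ?natrM //.
  (* For m >= 2 the natural subtraction is exact, since t > 0 gives t + 1 <= m t. *)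
  have : (2 <= m)%N by near: m; exists 2%N.
  by nia.
(* The two binomials have the same normalized limit, as their arguments differ by the constant t +
   1. *)
apply: (@squeeze_cvgr _ _ _ _ (fun=> 0)
  (fun m => C (fun m => (m * t)%N) m - C (fun m => (m * t - t.+1)%N) m)).
- near=> m.
  rewrite divr_ge0 ?exprn_ge0 //= /C -mulrBl.
  rewrite ler_wpM2r ?invr_ge0 ?exprn_ge0 // lerBrDr -natrD ler_nat.
  have [m' Em] : exists m', m = m'.+2.
    have : (2 <= m)%N by near: m; exists 2%N.
    by case: (m) => [|[|m']] // _; exists m'.
  rewrite Em; apply: (@graded_dim_mul _ _ _ (fermat K n t.+1) t.+1).
  + exact: symbolic_power_ideal.
  + exact: fermat_neq0.
  + exact: fermat_homog.
  + by nia.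
  + move=> g hg /(symbolic_power_fermat charK0 Irad Ihom IX) Ig.
    by apply: (I0 _ _ _ Ig hg); nia.
- exact: cvg_cst.
- by rewrite -(subrr (t%:R ^+ n / n`!%:R)); apply: cvgB.
Unshelve. all: by end_near. Qed.

End Waldschmidt.

Theorem theorem7 (R : realType) (K : closedFieldType)
    (charK0 : [pchar K] =i pred0)
    (n : nat) (n_gt0 : (0 < n)%N)
    (I : set {mpoly K[n.+1]})
    (I_radical : radical_ideal I) (I_homog : homogeneous I)
    (t : nat) (t_gt0 : (0 < t)%N) :
  exists l : R,
    (fun m : nat =>
       (hilbert_function (symbolic_power I m) (m * t))%:R / m%:R ^+ n : R)
      @ \oo --> l.
Proof.
pose a m := graded_dim (symbolic_power I m) (m * t).
pose C m := 'C(m * t + n, m * t).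
have C_cvg : (fun m => (C m)%:R / m%:R ^+ n : R) @ \oo --> (t%:R ^+ n / n`!%:R : R).
  exact: cvg_binomial_mul.
suff [l a_cvg] : exists l : R, (fun m => (a m)%:R / m%:R ^+ n : R) @ \oo --> l.
  exists (t%:R ^+ n / n`!%:R - l).
  have -> : (fun m : nat => (hilbert_function (symbolic_power I m) (m * t))%:R / m%:R ^+ n : R)
    = (fun m => (C m)%:R / m%:R ^+ n - (a m)%:R / m%:R ^+ n).
    apply/funext => m; rewrite -mulrBl; congr (_ / _).
    rewrite /C -(hilbert_function_dim (m * t) (symbolic_power_ideal I m)).
    by rewrite natrD addrK.
  exact: cvgB.
(* If I contains all variables, it is the irrelevant or the unit ideal, and a monomial of degree m t
   >= m is a product of at least m elements of I. *)
have [IX|/existsNP[i0 IX]] := pselect (forall i, I 'X_i).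
  exists (t%:R ^+ n / n`!%:R); suff -> : a = C by [].
  apply/funext => m; apply: graded_dim_full; first exact: symbolic_power_ideal.
  move=> f hf; apply: sub_symbolic_power; apply: homog_ideal_power hf => //.
  exact: leq_pmulr.
have [[m0 [d0 [f0 [If0 f0N0 hf0 d0_lt]]]]|no_f0] := pselect
  (exists m0 d0 (f0 : {mpoly K[n.+1]}),
    [/\ symbolic_power I m0 f0, f0 != 0, f0 \is d0.-homog & (d0 < m0 * t)%N]).
  exact: (cvg_graded_dim_big _ If0 f0N0 hf0 d0_lt).
exists 0; apply: (cvg_graded_dim_small charK0 t_gt0 I_radical I_homog IX).
move=> m d f If hf dm; apply: contrapT => /eqP f0.
by apply: no_f0; exists m, d, f.
Qed.
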